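(* Let $E=(E^0,E^1,r,s)$ be a finite source-free graph and $K$ any field. Then the Leavitt path algebra $L_K(E)$ has Unbounded Generating Number if and only if $E$ contains a source cycle.
   Context: A ring $R$ (nonzero, associative, with identity) has Unbounded Generating Number (UGN) if, for each positive integer $m$, any set of generators for the free right $R$-module $R^m$ has cardinality $\geq m$. A (directed) graph $E=(E^0,E^1,s,r)$ consists of disjoint sets $E^0$ (vertices) and $E^1$ (edges) and maps $s,r:E^1\to E^0$ (source and range); it is finite if $E^0$ and $E^1$ are finite. Graphs are assumed to have at least one vertex. A vertex $v$ is a source if $r^{-1}(v)=\emptyset$, and regular if $0<|s^{-1}(v)|<\infty$. A graph is source-free if it has no sources. For a field $K$, $L_K(E)$ is the $K$-algebra generated by the set $\{v,e,e^*\mid v\in E^0,e\in E^1\}$ subject to, for all $v,w\in E^0$, $e,f\in E^1$: (1) $vw=\delta_{v,w}w$; (2) $s(e)e=e=er(e)$ and $r(e)e^*=e^*=e^*s(e)$; (3) $e^*f=\delta_{e,f}r(e)$; (4) $v=\sum_{e\in s^{-1}(v)}ee^*$ for every regular vertex $v$. For finite $E$ it is unital with identity $\sum_{v\in E^0}v$. A closed path is a sequence of edges $e_1\cdots e_n$ ($n\ge 1$) with $r(e_i)=s(e_{i+1})$ for $1\le i<n$ and $r(e_n)=s(e_1)$. If the vertices $s(e_1),\dots,s(e_n)$ are distinct, the subgraph $c$ with vertex set $c^0=\{s(e_1),\dots,s(e_n)\}$ and edge set $\{e_1,\dots,e_n\}$ is called a cycle. A cycle $c$ in $E$ is a source cycle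 if $|r^{-1}(v)|=1$ for all $v\in c^0$. *)

(* Defs.v *)
From HB Require Import structures.
From mathcomp Require Import all_boot all_algebra generic_quotient.
From mathcomp Require Import boolp classical_sets functions cardinality.

Set Implicit Arguments.
Unset Strict Implicit.
Unset Printing Implicit Defensive.

Import GRing.Theory.
Local Open Scope ring_scope.
Local Open Scope quotient_scope.

(** * Unbounded Generating Number *)

(* R^m is 'cV[R]_m; its right R-module structure is v, a |-> v *m a%:M, i.e.
   every coordinate is multiplied by a on the right (the library's *: acts on
   the left). *)
Definition right_generates (R : nzRingType) (m : nat) (G : set 'cV[R]_m) :=
  forall x : 'cV[R]_m, exists (n : nat) (g : 'I_n -> 'cV[R]_m) (a : 'I_n -> R),
    (forall i, G (g i)) /\ x = \sum_(i < n) g i *m (a i)%:M.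

(* G is an arbitrary, possibly infinite, set. *)
Definition UGN (R : nzRingType) : Prop :=
  forall m : nat, (0 < m)%N ->
  forall G : set 'cV[R]_m, right_generates G -> (`I_m #<= G)%card.

(** * Finite graphs *)

Record fin_graph := FinGraph {
  vertex : finType;
  edge : finType;
  src : edge -> vertex;
  rng : edge -> vertex;
  vertex_gt0 : (0 < #|vertex|)%N
}.
Arguments src {f} _.
Arguments rng {f} _.

Section Graph.
Variable E : fin_graph.
Implicit Types (v : vertex E) (p : seq (edge E)).

Definition out_edges v : {set edge E} := [set e | src e == v]%SET.
Definition in_edges v : {set edge E} := [set e | rng e == v]%SET.

Definition is_source v := in_edges v == finset.set0.
(* Finiteness of out_edges v is automatic here. *)
Definition regular v := (0 < #|out_edges v|)%N.

Definition source_free := forall v, ~~ is_source v.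

(* path.cycle also requires the last edge to end where the first one starts,
   but it accepts the empty sequence. *)
Definition closed_path p :=
  (p != [::]) && path.cycle (fun e f : edge E => rng e == src f) p.

Definition is_cycle p := closed_path p && uniq (map src p).

Definition source_cycle p :=
  is_cycle p && all (fun v => #|in_edges v| == 1%N) (map src p).

Definition has_source_cycle := exists p, source_cycle p.

End Graph.

(** * Leavitt path algebras *)

Section Leavitt.
Variables (K : fieldType) (E : fin_graph).

(* Formal (non-unital) K-algebra expressions in the generators v, e, e^*;
   -t is the expression TScale (-1) t. *)
Inductive lterm : Type :=
| TVert of vertex E
| TEdge of edge E
| TGhost of edge E
| TZero
| TAdd of lterm & lterm
| TScale of K & lterm
| TMul of lterm & lterm.

HB.instance Definition _ := gen_eqMixin lterm.
HB.instance Definition _ := gen_choiceMixin lterm.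

Local Infix "+t" := TAdd (at level 50, left associativity).
Local Infix "*t" := TMul (at level 40, left associativity).
Local Infix ":*t" := TScale (at level 40, left associativity).

(* The least congruence containing the laws of associative K-algebras and the
   Leavitt relations (from lrel_vert on). That 1 is the sum of the vertices is
   proved below, not imposed. *)
Inductive lrel : lterm -> lterm -> Prop :=
| lrel_refl t : lrel t t
| lrel_sym t u : lrel t u -> lrel u t
| lrel_trans t u w : lrel t u -> lrel u w -> lrel t w
| lrel_add t t' u u' : lrel t t' -> lrel u u' -> lrel (t +t u) (t' +t u')
| lrel_scale a t t' : lrel t t' -> lrel (a :*t t) (a :*t t')
| lrel_mul t t' u u' : lrel t t' -> lrel u u' -> lrel (t *t u) (t' *t u')
| lrel_addA t u w : lrel (t +t (u +t w)) (t +t u +t w)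
| lrel_addC t u : lrel (t +t u) (u +t t)
| lrel_add0 t : lrel (TZero +t t) t
| lrel_addN t : lrel ((-1) :*t t +t t) TZero
| lrel_scaleA a b t : lrel (a :*t (b :*t t)) ((a * b) :*t t)
| lrel_scale1 t : lrel (1 :*t t) t
| lrel_scaleDr a t u : lrel (a :*t (t +t u)) (a :*t t +t a :*t u)
| lrel_scaleDl a b t : lrel ((a + b) :*t t) (a :*t t +t b :*t t)
| lrel_mulA t u w : lrel (t *t (u *t w)) (t *t u *t w)
| lrel_mulDl t u w : lrel ((t +t u) *t w) (t *t w +t u *t w)
| lrel_mulDr t u w : lrel (t *t (u +t w)) (t *t u +t t *t w)
| lrel_scaleAl a t u : lrel (a :*t (t *t u)) ((a :*t t) *t u)
| lrel_scaleAr a t u : lrel (a :*t (t *t u)) (t *t (a :*t u))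
| lrel_vert v w :
    lrel (TVert v *t TVert w) (if v == w then TVert w else TZero)
| lrel_src_edge e : lrel (TVert (src e) *t TEdge e) (TEdge e)
| lrel_edge_rng e : lrel (TEdge e *t TVert (rng e)) (TEdge e)
| lrel_rng_ghost e : lrel (TVert (rng e) *t TGhost e) (TGhost e)
| lrel_ghost_src e : lrel (TGhost e *t TVert (src e)) (TGhost e)
| lrel_ghost_edge e f :
    lrel (TGhost e *t TEdge f) (if e == f then TVert (rng e) else TZero)
| lrel_regular v : regular v ->
    lrel (TVert v) (\big[TAdd/TZero]_(e in out_edges v) (TEdge e *t TGhost e)).

Let lrelb (t u : lterm) : bool := `[< lrel t u >].

Fact lrelb_refl : reflexive lrelb.
Proof. by move=> t; apply/asboolP/lrel_refl. Qed.
Fact lrelb_sym : symmetric lrelb.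
Proof. by move=> t u; apply/asboolP/asboolP; apply: lrel_sym. Qed.
Fact lrelb_trans : transitive lrelb.
Proof.
by move=> t u w /asboolP ut /asboolP tw; apply/asboolP/(lrel_trans ut).
Qed.

Definition lequiv := EquivRel lrelb lrelb_refl lrelb_sym lrelb_trans.

Definition leavitt : Type := {eq_quot lequiv}.
HB.instance Definition _ := Choice.on leavitt.
HB.instance Definition _ := EqQuotient.on leavitt.

Definition lclass (t : lterm) : leavitt := \pi_leavitt t.

Lemma lclassP t u : lclass t = lclass u <-> lrel t u.
Proof.
rewrite /lclass; split=> [/eqquotP/asboolP //|h].
by apply/eqquotP/asboolP.
Qed.

Lemma lclassW (P : leavitt -> Prop) : (forall t, P (lclass t)) -> forall x, P x.
Proof. by move=> h x; rewrite -[x]reprK; apply: h. Qed.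

Lemma lrepr t : lrel (repr (lclass t)) t.
Proof. by apply/lclassP; rewrite /lclass reprK. Qed.

Definition lzero := lclass TZero.
Definition ladd (x y : leavitt) := lclass (repr x +t repr y).
Definition lscale (a : K) (x : leavitt) := lclass (a :*t repr x).
Definition lmul (x y : leavitt) := lclass (repr x *t repr y).
Definition lopp := lscale (-1).
Definition lone_term := \big[TAdd/TZero]_(v : vertex E) TVert v.
Definition lone := lclass lone_term.

Lemma laddE t u : ladd (lclass t) (lclass u) = lclass (t +t u).
Proof. by apply/lclassP/lrel_add; apply: lrepr. Qed.
Lemma lscaleE a t : lscale a (lclass t) = lclass (a :*t t).
Proof. by apply/lclassP/lrel_scale; apply: lrepr. Qed.
Lemma lmulE t u : lmul (lclass t) (lclass u) = lclass (t *t u).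
Proof. by apply/lclassP/lrel_mul; apply: lrepr. Qed.

Ltac lift_law law :=
  repeat elim/lclassW => ?;
  rewrite /lopp /lzero ?(laddE, lscaleE, lmulE); apply/lclassP; exact: law.

Fact laddA : associative ladd. Proof. lift_law lrel_addA. Qed.
Fact laddC : commutative ladd. Proof. lift_law lrel_addC. Qed.
Fact ladd0 : left_id lzero ladd. Proof. lift_law lrel_add0. Qed.
Fact laddN : left_inverse lzero lopp ladd. Proof. lift_law lrel_addN. Qed.

HB.instance Definition _ :=
  GRing.isZmodule.Build leavitt laddA laddC ladd0 laddN.

Fact lscaleA a b x : lscale a (lscale b x) = lscale (a * b) x.
Proof. move: x; lift_law lrel_scaleA. Qed.
Fact lscale1 : left_id 1 lscale. Proof. lift_law lrel_scale1. Qed.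
Fact lscaleDr : right_distributive lscale ladd.
Proof. move=> a; lift_law lrel_scaleDr. Qed.
Fact lscaleDl x : {morph lscale^~ x : a b / a + b >-> ladd a b}.
Proof. move=> a b; move: x; lift_law lrel_scaleDl. Qed.

HB.instance Definition _ := GRing.Zmodule_isLmodule.Build K leavitt
  lscaleA lscale1 lscaleDr lscaleDl.

Fact lmulA : associative lmul. Proof. lift_law lrel_mulA. Qed.
Fact lmulDl : left_distributive lmul ladd. Proof. lift_law lrel_mulDl. Qed.
Fact lmulDr : right_distributive lmul ladd. Proof. lift_law lrel_mulDr. Qed.

Lemma lclass_sum (I : finType) (P : pred I) (F : I -> lterm) :
  lclass (\big[TAdd/TZero]_(i | P i) F i) = \sum_(i | P i) lclass (F i).
Proof. by apply: big_morph => // t u; rewrite -laddE. Qed.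

Lemma lmul0 x : lmul 0 x = 0.
Proof.
have h : lmul (0 + 0) x = lmul 0 x + lmul 0 x := lmulDl _ _ _.
by apply: (addIr (lmul 0 x)); rewrite -h !add0r.
Qed.
Lemma lmulr0 x : lmul x 0 = 0.
Proof.
have h : lmul x (0 + 0) = lmul x 0 + lmul x 0 := lmulDr _ _ _.
by apply: (addIr (lmul x 0)); rewrite -h !add0r.
Qed.

Lemma lmul_suml (I : finType) (P : pred I) (F : I -> leavitt) x :
  lmul (\sum_(i | P i) F i) x = \sum_(i | P i) lmul (F i) x.
Proof.
by apply: (big_morph (lmul^~ x)); [move=> ? ?; apply: lmulDl | apply: lmul0].
Qed.
Lemma lmul_sumr (I : finType) (P : pred I) (F : I -> leavitt) x :
  lmul x (\sum_(i | P i) F i) = \sum_(i | P i) lmul x (F i).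
Proof.
by apply: (big_morph (lmul x)); [move=> ? ?; apply: lmulDr | apply: lmulr0].
Qed.

Lemma lvertM v w :
  lmul (lclass (TVert v)) (lclass (TVert w)) =
  if v == w then lclass (TVert w) else 0.
Proof.
have /lclassP := lrel_vert v w; rewrite -lmulE => ->.
by case: eqP.
Qed.

Lemma lone_fixl v x : lmul (lclass (TVert v)) x = x -> lmul lone x = x.
Proof.
move=> vx; rewrite -vx lmulA; congr lmul.
rewrite /lone lclass_sum lmul_suml (bigD1 v) //= lvertM eqxx.
by rewrite big1 ?addr0 // => w /negPf wv; rewrite lvertM wv.
Qed.

Lemma lone_fixr v x : lmul x (lclass (TVert v)) = x -> lmul x lone = x.
Proof.
move=> xv; rewrite -xv -lmulA; congr lmul.
rewrite /lone lclass_sum lmul_sumr (bigD1 v) //= lvertM eqxx.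
by rewrite big1 ?addr0 // => w; rewrite lvertM eq_sym => /negPf ->.
Qed.

Fact lmul1 : left_id lone lmul.
Proof.
elim/lclassW; elim=> [v|e|e||t IHt u IHu|a t IHt|t IHt u IHu].
- by apply: (@lone_fixl v); rewrite lvertM eqxx.
- by apply: (@lone_fixl (src e)); rewrite lmulE; apply/lclassP/lrel_src_edge.
- by apply: (@lone_fixl (rng e)); rewrite lmulE; apply/lclassP/lrel_rng_ghost.
- exact: lmulr0.
- by rewrite -laddE [LHS]lmulDr IHt IHu.
- rewrite -[in RHS]lscaleE -[in RHS]IHt !lmulE lscaleE.
  by apply/lclassP/lrel_sym/lrel_scaleAr.
- by rewrite -lmulE lmulA IHt.
Qed.

Fact lmulr1 : right_id lone lmul.
Proof.
elim/lclassW; elim=> [v|e|e||t IHt u IHu|a t IHt|t IHt u IHu].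
- by apply: (@lone_fixr v); rewrite lvertM eqxx.
- by apply: (@lone_fixr (rng e)); rewrite lmulE; apply/lclassP/lrel_edge_rng.
- by apply: (@lone_fixr (src e)); rewrite lmulE; apply/lclassP/lrel_ghost_src.
- exact: lmul0.
- by rewrite -laddE [LHS]lmulDl IHt IHu.
- rewrite -[in RHS]lscaleE -[in RHS]IHt !lmulE lscaleE.
  by apply/lclassP/lrel_sym/lrel_scaleAl.
- by rewrite -lmulE -lmulA IHu.
Qed.

(* 1 != 0 is proved with the representation on functions vertex E -> nat -> K
   where, v having d out-edges, the i-th of them maps the k-th coordinate at
   its range to the (k * d + i)-th coordinate at v. *)
Local Notation vect := (vertex E -> nat -> K).

Let pos (e : edge E) := index e (enum (out_edges (src e))).
Let deg v := #|out_edges (E := E) v|.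

Let pos_lt e : (pos e < deg (src e))%N.
Proof. by rewrite /deg cardE index_mem mem_enum inE. Qed.

Let pos_inj e f : src e = src f -> pos e = pos f -> e = f.
Proof.
rewrite /pos => -> /(congr1 (nth e (enum (out_edges (src f))))).
have [se|] := boolP (e \in out_edges (src f)); last first.
  move=> enf; rewrite [in LHS]nth_default; last first.
    by rewrite leqNgt index_mem mem_enum.
  by rewrite nth_index // mem_enum inE.
by rewrite !nth_index // mem_enum // inE.
Qed.

Fixpoint lact (t : lterm) (f : vect) : vect :=
  match t with
  | TVert v => fun w k => if w == v then f w k else 0
  | TEdge e => fun w k =>
      if (w == src e) && (k %% deg (src e) == pos e)%N
      then f (rng e) (k %/ deg (src e))%N else 0
  | TGhost e => fun w k =>
      if w == rng e then f (src e) (k * deg (src e) + pos e)%N else 0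
  | TZero => fun _ _ => 0
  | TAdd t u => fun w k => lact t f w k + lact u f w k
  | TScale a t => fun w k => a * lact t f w k
  | TMul t u => lact t (lact u f)
  end.

Lemma lactD t f g w k :
  lact t (fun w k => f w k + g w k) w k = lact t f w k + lact t g w k.
Proof.
elim: t f g w k => [v|e|e||t IHt u IHu|a t IHt|t IHt u IHu] f g w k /=.
- by case: ifP; rewrite ?addr0.
- by case: ifP; rewrite ?addr0.
- by case: ifP; rewrite ?addr0.
- by rewrite addr0.
- by rewrite IHt IHu addrACA.
- by rewrite IHt mulrDr.
- rewrite -IHt; congr (lact t _ w k).
  by apply/funext => ?; apply/funext => ?; rewrite IHu.
Qed.

Lemma lactZ t a f w k :
  lact t (fun w k => a * f w k) w k = a * lact t f w k.
Proof.
elim: t f w k => [v|e|e||t IHt u IHu|b t IHt|t IHt u IHu] f w k /=.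
- by case: ifP; rewrite ?mulr0.
- by case: ifP; rewrite ?mulr0.
- by case: ifP; rewrite ?mulr0.
- by rewrite mulr0.
- by rewrite IHt IHu mulrDr.
- by rewrite IHt mulrCA.
- rewrite -IHt; congr (lact t _ w k).
  by apply/funext => ?; apply/funext => ?; rewrite IHu.
Qed.

Lemma lact_sum (I : finType) (P : pred I) (F : I -> lterm) f w k :
  lact (\big[TAdd/TZero]_(i | P i) F i) f w k = \sum_(i | P i) lact (F i) f w k.
Proof. exact: (big_morph (fun t => lact t f w k)). Qed.

Lemma lact_edge_ghost e f w k :
  lact (TEdge e *t TGhost e) f w k =
  if (w == src e) && (k %% deg (src e) == pos e)%N then f w k else 0.
Proof.
rewrite /= eqxx; case: ifP => // /andP[/eqP-> /eqP<-].
by rewrite -divn_eq.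
Qed.

Lemma lact_rel t u : lrel t u -> lact t = lact u.
Proof.
elim=> {t u} //=.
- by move=> t u w _ -> _ ->.
- by move=> t t' u u' _ -> _ ->.
- by move=> a t t' _ ->.
- by move=> t t' u u' _ -> _ ->.
- by move=> *; apply/funext => ?; do 2!apply/funext => ?; rewrite addrA.
- by move=> *; apply/funext => ?; do 2!apply/funext => ?; rewrite addrC.
- by move=> *; apply/funext => ?; do 2!apply/funext => ?; rewrite add0r.
- by move=> *; apply/funext => ?; do 2!apply/funext => ?; rewrite mulN1r addNr.
- by move=> *; apply/funext => ?; do 2!apply/funext => ?; rewrite mulrA.
- by move=> *; apply/funext => ?; do 2!apply/funext => ?; rewrite mul1r.
- by move=> *; apply/funext => ?; do 2!apply/funext => ?; rewrite mulrDr.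
- by move=> *; apply/funext => ?; do 2!apply/funext => ?; rewrite mulrDl.
- by move=> *; apply/funext => ?; do 2!apply/funext => ?; rewrite lactD.
- by move=> *; apply/funext => ?; do 2!apply/funext => ?; rewrite lactZ.
- move=> v w; apply/funext => f; do 2!apply/funext => ?.
  case: (altP (v =P w)) => [->|vw] /=; first by case: ifP => [->|].
  by case: eqP => // ->; rewrite (negPf vw).
- move=> e; apply/funext => f; do 2!apply/funext => ?.
  by case: eqP.
- by move=> e; apply/funext => f; do 2!apply/funext => ?; rewrite eqxx.
- move=> e; apply/funext => f; do 2!apply/funext => ?.
  by case: eqP.
- by move=> e; apply/funext => f; do 2!apply/funext => ?; rewrite eqxx.
- move=> e g; apply/funext => f; apply/funext => w; apply/funext => k.
  case: (altP (e =P g)) => [<-|eg] /=.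
    rewrite eqxx modnMDl modn_small ?pos_lt // eqxx /=.
    rewrite divnMDl ?(leq_ltn_trans _ (pos_lt e)) // divn_small ?pos_lt //.
    by rewrite addn0; case: eqP => // ->.
  case: ifP => // _; case: ifP => // /andP[/eqP se].
  rewrite -se modnMDl modn_small ?pos_lt // => /eqP pe.
  by rewrite (pos_inj se pe) eqxx in eg.
- move=> v; rewrite /regular => v_gt0.
  apply/funext => f; apply/funext => w; apply/funext => k.
  rewrite lact_sum (eq_bigr _ (fun e _ => lact_edge_ghost e f w k)) /=.
  have [->|wv] := eqVneq w v; last first.
    by rewrite big1 // => e; rewrite inE => /eqP->; rewrite (negPf wv).
  have kv : (k %% deg v < size (enum (out_edges v)))%N.
    by rewrite -cardE ltn_mod.
  have [e0 _] : {e | e \in out_edges v} by apply/sigW/card_gt0P.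
  pose e := nth e0 (enum (out_edges v)) (k %% deg v).
  have ev : e \in out_edges v by rewrite -mem_enum mem_nth.
  have se : src e = v by move: ev; rewrite inE => /eqP.
  have pe : pos e = (k %% deg v)%N by rewrite /pos se index_uniq ?enum_uniq.
  rewrite (bigD1 e) //= se !eqxx pe eqxx /= big1 ?addr0 // => g.
  rewrite inE => /andP[/eqP sg ge]; rewrite sg eqxx /=.
  case: eqP => // pg; have := ge; rewrite (@pos_inj g e) ?eqxx ?sg ?se //.
  by rewrite pe pg.
Qed.

Fact lone_neq0 : lone != 0.
Proof.
apply/eqP => /lclassP/lact_rel/(congr1 (fun F => F (fun _ _ => 1))).
have [v _] : {v : vertex E | v \in vertex E} by apply/sigW/card_gt0P/vertex_gt0.
move=> /(congr1 (fun f => f v 0%N)); rewrite lact_sum /= (bigD1 v) //= eqxx.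
rewrite big1 ?addr0; last by move=> w; rewrite eq_sym => /negPf ->.
by move/eqP; rewrite oner_eq0.
Qed.

HB.instance Definition _ := GRing.Zmodule_isNzRing.Build leavitt
  lmulA lmul1 lmulr1 lmulDl lmulDr lone_neq0.

Fact lscaleAl a x y : lscale a (lmul x y) = lmul (lscale a x) y.
Proof. move: x y; lift_law lrel_scaleAl. Qed.
Fact lscaleAr a x y : lscale a (lmul x y) = lmul x (lscale a y).
Proof. move: x y; lift_law lrel_scaleAr. Qed.

HB.instance Definition _ :=
  GRing.Lmodule_isLalgebra.Build K leavitt lscaleAl.
HB.instance Definition _ :=
  GRing.Lalgebra_isAlgebra.Build K leavitt lscaleAr.

End Leavitt.

(* Main.v *)
(* If p is a source cycle, no edge outside p enters it, so sending the vertices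
   and edges off p to 0 and those on p to matrix units is a unital
   representation of L_K(E) on K^(size p); a generating set of R^m with n
   elements becomes a surjection K^(n * size p) -> K^(m * size p).
   Without a source cycle, there is a length k such that each vertex v is the
   end of two distinct paths p_v and q_v of length k.  Since paths of the same
   length satisfy a^* b = delta_(a,b) r(a), the column with entries sum p_v^*
   and sum q_v^* times the row with entries sum p_v and sum q_v is the 2 x 2
   identity matrix over R = L_K(E), and that column alone generates R^2. *)

Require Import Defs.
From mathcomp Require Import all_boot all_algebra.
From HB Require Import structures.
From mathcomp Require Import finmap boolp classical_sets functions cardinality.

Set Implicit Arguments.
Unset Strict Implicit.
Unset Printing Implicit Defensive.

Import GRing.Theory.
Local Open Scope ring_scope.

(** * UGN as a condition on rectangular matrices *)

Lemma mulmx_sum_col_scalar (R : nzRingType) m n (A : 'M[R]_(m, n))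
    (x : 'cV_n) :
  A *m x = \sum_(j < n) col j A *m (x j 0)%:M.
Proof.
apply/colP => i; rewrite mxE summxE; apply: eq_bigr => j _.
by rewrite !mxE big_ord1 !mxE eqxx mulr1n.
Qed.

(** The columns of [A] generate R^m exactly when [A] has a right inverse [B], whose columns are
    coordinates of the standard basis. An infinite generating set is always large enough. *)
Lemma UGN_matrixP (R : nzRingType) :
  UGN R <-> forall m n (A : 'M[R]_(m, n)) (B : 'M[R]_(n, m)),
    A *m B = 1%:M -> (m <= n)%N.
Proof.
split=> [ugn m n A B AB1 | minR m m_gt0 G genG].
  have [->|m_gt0] := posnP m; first exact: leq0n.
  have {ugn} := ugn m m_gt0 (range (fun j => col j A)).
  rewrite -card_le_II => ugn.
  have /card_le_trans : (`I_m #<= range (fun j => col j A))%card.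
    apply: ugn => x; exists n, (fun j => col j A), (fun j => (B *m x) j 0).
    split=> [j|]; first by exists j.
    by rewrite -mulmx_sum_col_scalar mulmxA AB1 mul1mx.
  (* Columns may coincide, so their set has at most [n] elements; this bound suffices. *)
  apply; apply: card_le_trans (card_image_le _ _) _.
  by rewrite (card_le_eqr card_II).
have [/finite_fsetP[X GX]|/infiniteP] := pselect (finite_set G); last first.
  by move/(card_le_trans _); apply; apply: subset_card_le.
have XE : ([set` X] #= `I_(size X))%card by apply/card_eq_fsetP.
rewrite GX (card_le_eqr XE) card_le_II.
pose A : 'M[R]_(m, size X) := \matrix_(i, j) (X`_j) i 0.
have genA x : exists b : 'cV_(size X), x = A *m b.
  have [n [g [a [Gg ->]]]] := genG x.
  have gA l : exists b : 'cV_(size X), g l = A *m b.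
    have Xg : g l \in (X : seq _) by move: (Gg l); rewrite GX.
    rewrite -index_mem in Xg; exists (delta_mx (Ordinal Xg) 0).
    rewrite -colE; apply/colP => i; rewrite !mxE nth_index // -index_mem.
    exact: Xg.
  have [b gE] := choice gA.
  exists (\sum_l b l *m (a l)%:M); rewrite mulmx_sumr.
  by apply: eq_bigr => l _; rewrite gE mulmxA.
have [b bE] := choice genA.
apply: (minR m _ A (\matrix_(i, j) b (delta_mx j 0) i 0)).
apply/matrixP => i j; have /colP/(_ i) := bE (delta_mx j 0).
rewrite !mxE eqxx andbT => ->; apply: eq_bigr => k _.
by rewrite !mxE.
Qed.

(** Applying [f] entrywise to [A *m B = 1%:M] gives an identity of block matrices over a field,
    where rank forces [m * n <= k * n]; then [n] cancels. *)
Lemma UGN_matrix_rep (R : nzRingType) (K : fieldType) (n : nat)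
    (f : {rmorphism R -> 'M[K]_n}) : (0 < n)%N -> UGN R.
Proof.
have fM x y : f x *m f y = f (x * y) by rewrite rmorphM.
move=> n_gt0; apply/UGN_matrixP => m k A B AB1.
have ABE i j : \sum_l A i l * B l j = (i == j)%:R.
  by move/matrixP/(_ i j): AB1; rewrite !mxE.
have /mulmx1_min : \mxblock_(i < m, j < k) f (A i j) *m
    \mxblock_(i < k, j < m) f (B i j) = 1%:M.
  rewrite mul_mxblock -[RHS](mxdiagZ (p_ := fun=> n)); apply/eq_mxblock => i j.
  under eq_bigr do rewrite fM.
  rewrite -rmorph_sum ABE.
  by case: eqP => _; rewrite ?rmorph1 ?conform_mx_id ?rmorph0.
by rewrite !sum_nat_const !card_ord leq_pmul2r.
Qed.

(** * Unital morphisms out of the Leavitt path algebra *)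

Section LeavittMorphism.
Variables (K : fieldType) (E : fin_graph) (A : algType K).
Variables (fv : vertex E -> A) (fe fg : edge E -> A).

Fixpoint leval (t : lterm K E) : A :=
  match t with
  | TVert v => fv v
  | TEdge e => fe e
  | TGhost e => fg e
  | TZero => 0
  | TAdd t u => leval t + leval u
  | TScale a t => a *: leval t
  | TMul t u => leval t * leval u
  end.

(** The Leavitt relations read in [A]. The other fields do not force [lfam_one] (all images could be
    0), which makes the induced morphism unital. *)
Record leavitt_family : Prop := LeavittFamily {
  lfam_vert v w : fv v * fv w = if v == w then fv w else 0;
  lfam_src_edge e : fv (src e) * fe e = fe e;
  lfam_edge_rng e : fe e * fv (rng e) = fe e;
  lfam_rng_ghost e : fv (rng e) * fg e = fg e;
  lfam_ghost_src e : fg e * fv (src e) = fg e;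
  lfam_ghost_edge e f : fg e * fe f = if e == f then fv (rng e) else 0;
  lfam_regular v : regular v -> fv v = \sum_(e in out_edges v) fe e * fg e;
  lfam_one : \sum_v fv v = 1
}.

Hypothesis fam : leavitt_family.

Lemma leval_sum (I : finType) (P : pred I) (F : I -> lterm K E) :
  leval (\big[@TAdd K E/TZero K E]_(i | P i) F i) = \sum_(i | P i) leval (F i).
Proof. exact: (big_morph leval). Qed.

Lemma leval_rel t u : lrel t u -> leval t = leval u.
Proof.
elim=> {t u} //=.
- by move=> t u w _ -> _ ->.
- by move=> t t' u u' _ -> _ ->.
- by move=> a t t' _ ->.
- by move=> t t' u u' _ -> _ ->.
- by move=> *; rewrite addrA.
- by move=> *; rewrite addrC.
- by move=> *; rewrite add0r.
- by move=> *; rewrite scaleN1r addNr.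
- by move=> *; rewrite scalerA.
- by move=> *; rewrite scale1r.
- by move=> *; rewrite scalerDr.
- by move=> *; rewrite scalerDl.
- by move=> *; rewrite mulrA.
- by move=> *; rewrite mulrDl.
- by move=> *; rewrite mulrDr.
- by move=> *; rewrite scalerAl.
- by move=> *; rewrite scalerAr.
- by move=> v w; rewrite (lfam_vert fam); case: eqP.
- exact: lfam_src_edge.
- exact: lfam_edge_rng.
- exact: lfam_rng_ghost.
- exact: lfam_ghost_src.
- by move=> e f; rewrite (lfam_ghost_edge fam); case: eqP.
- by move=> v v_reg; rewrite leval_sum (lfam_regular fam).
Qed.

Definition lift_leavitt (x : leavitt K E) : A := leval (repr x).

Lemma lift_leavittE t : lift_leavitt (lclass t) = leval t.
Proof. exact/leval_rel/lrepr. Qed.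

Fact lift_leavitt_is_zmod : zmod_morphism lift_leavitt.
Proof.
move=> x y; rewrite [LHS]lift_leavittE /=; congr (_ + _).
(* The opposite in the quotient is scaling by -1. *)
by rewrite -[LHS]/(lift_leavitt (lclass _)) lift_leavittE /= scaleN1r.
Qed.

Fact lift_leavitt_is_monoid : monoid_morphism lift_leavitt.
Proof.
split; last by move=> x y; rewrite [LHS]lift_leavittE.
by rewrite [LHS]lift_leavittE leval_sum (lfam_one fam).
Qed.

HB.instance Definition _ :=
  GRing.isZmodMorphism.Build (leavitt K E) A lift_leavitt lift_leavitt_is_zmod.
HB.instance Definition _ :=
  GRing.isMonoidMorphism.Build (leavitt K E) A lift_leavitt
    lift_leavitt_is_monoid.

Definition lift_leavitt_rmorphism : {rmorphism leavitt K E -> A} :=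
  lift_leavitt.

End LeavittMorphism.

(** * The matrix representation attached to a source cycle *)

Section SourceCycle.
Variables (K : fieldType) (E : fin_graph) (p : seq (edge E)).
Hypothesis p_cycle : source_cycle p.

Let vs := map src p.
Let n := (size p).-1.

Let size_vs : size vs = n.+1.
Proof.
rewrite size_map prednK // lt0n size_eq0.
by case/andP: p_cycle => /andP[/andP[]].
Qed.

Let vs_uniq : uniq vs. Proof. by case/andP: p_cycle => /andP[]. Qed.

Let p_path : path.cycle (fun e f : edge E => rng e == src f) p.
Proof. by case/andP: p_cycle => /andP[/andP[]]. Qed.

Let src_inj : {in p &, injective src}.
Proof.
move=> e f ep fp /(congr1 (index^~ vs)); rewrite /vs.
rewrite -(nth_index e ep) -(nth_index e fp) -!(nth_map _ (src e)) ?index_mem //.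
by rewrite !index_uniq ?size_map ?index_mem // => ->.
Qed.

(* Only this equivalence uses that p is a source cycle and not just a cycle. *)
Let rng_vs e : (rng e \in vs) = (e \in p).
Proof.
apply/idP/idP => [/mapP[f fp ef]|ep]; last first.
  by rewrite (eqP (next_cycle p_path ep)) map_f ?mem_next.
have /andP[_ /allP/(_ _ (map_f src fp))/cards1P[g in_f]] := p_cycle.
have gE h : rng h == src f -> h = g.
  by move=> hf; apply/set1P; rewrite -in_f inE.
by rewrite (gE e) ?ef // -(gE _ (prev_cycle p_path fp)) mem_prev.
Qed.

Let idx v : 'I_n.+1 := inord (index v vs).

Let idx_inj : {in vs &, injective idx}.
Proof.
move=> v w vv wv /(congr1 val) /=; rewrite !inordK -?size_vs ?index_mem //.
exact: index_inj.
Qed.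

Definition cycle_vert v : 'M[K]_n.+1 :=
  if v \in vs then delta_mx (idx v) (idx v) else 0.
Definition cycle_edge e : 'M[K]_n.+1 :=
  if e \in p then delta_mx (idx (src e)) (idx (rng e)) else 0.
Definition cycle_ghost e : 'M[K]_n.+1 :=
  if e \in p then delta_mx (idx (rng e)) (idx (src e)) else 0.

(** Everything reduces to products of matrix units. For [lfam_regular], by [src_inj] a single edge
    of [p] leaves each vertex of the cycle, so one term of the sum survives; off the cycle both
    sides vanish. *)
Lemma cycle_family : leavitt_family cycle_vert cycle_edge cycle_ghost.
Proof.
have src_vs e : e \in p -> src e \in vs by exact: map_f.
rewrite /cycle_vert /cycle_edge /cycle_ghost; split.
- move=> v w; case: eqVneq => [->|vw]; case: ifP => wv; rewrite ?mulr0 ?mul0r //.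
    by rewrite [LHS]mul_delta_mx.
  case: ifP => vv; rewrite ?mulr0 //.
  by rewrite [LHS]mul_delta_mx_0 // (inj_in_eq idx_inj).
- move=> e; case ep: (e \in p); rewrite ?mulr0 // src_vs //.
  exact: mul_delta_mx.
- move=> e; rewrite rng_vs; case ep: (e \in p); rewrite ?mulr0 //.
  exact: mul_delta_mx.
- move=> e; rewrite rng_vs; case ep: (e \in p); rewrite ?mulr0 //.
  exact: mul_delta_mx.
- move=> e; case ep: (e \in p); rewrite ?mul0r // src_vs //.
  exact: mul_delta_mx.
- move=> e f; rewrite rng_vs; case: eqVneq => [<-|ef].
    by case: ifP => ep; rewrite ?mulr0 //; exact: mul_delta_mx.
  case: ifP => ep; rewrite ?mul0r //; case: ifP => fp; rewrite ?mulr0 //.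
  rewrite [LHS]mul_delta_mx_0 // (inj_in_eq idx_inj) ?src_vs //.
  by rewrite (inj_in_eq src_inj).
- move=> v _; case: ifP => [/mapP[e ep ->]|vv].
    rewrite (bigD1 e) ?inE //= ep big1 ?addr0.
      by symmetry; exact: mul_delta_mx.
    move=> f /andP[]; rewrite inE => /eqP fe nfe; case: ifP => fp.
      by rewrite (src_inj fp ep fe) eqxx in nfe.
    by rewrite mul0r.
  rewrite big1 // => e; rewrite inE => /eqP ev; case: ifP => ep.
    by rewrite -ev src_vs in vv.
  by rewrite mul0r.
- rewrite -big_mkcond /= -big_uniq //=.
  (* A default value for [nth]. *)
  have v0 : vertex E by case: (vs) size_vs.
  rewrite (big_nth v0) size_vs big_mkord [RHS]mx1_sum_delta.
  apply: eq_bigr => i _; suff ->: idx (nth v0 vs i) = i by [].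
  by rewrite /idx index_uniq ?size_vs // inord_val.
Qed.

Lemma source_cycle_UGN : UGN (leavitt K E).
Proof. exact: UGN_matrix_rep (lift_leavitt_rmorphism cycle_family) _. Qed.

End SourceCycle.

(** * Counting paths that end at a given vertex *)

Section BackwardPaths.
Variable E : fin_graph.

(* Paths are listed from their last edge to their first. *)
Fixpoint path_to (v : vertex E) (q : seq (edge E)) : bool :=
  if q is e :: q' then (rng e == v) && path_to (src e) q' else true.

Fixpoint origin (v : vertex E) (q : seq (edge E)) : vertex E :=
  if q is e :: q' then origin (src e) q' else v.

Lemma path_to_cat v q r :
  path_to v (q ++ r) = path_to v q && path_to (origin v q) r.
Proof. by elim: q v => //= e q IHq v; rewrite IHq andbA. Qed.

Hypothesis E_source_free : source_free E.

Lemma source_free_path_to v k : exists2 q, size q = k & path_to v q.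
Proof.
elim: k v => [|k IHk] v; first by exists [::].
have /set0Pn[e] := E_source_free v; rewrite inE => ev.
have [q qk qe] := IHk (src e); exists (e :: q); rewrite /= ?qk //.
by rewrite ev.
Qed.

Definition two_paths_to v k :=
  exists q, [/\ size q.1 = k, size q.2 = k, path_to v q.1, path_to v q.2 &
                q.1 != q.2].

(** Both paths are prolonged backwards from their origins, which is possible without sources; they
    still differ in their last [k] edges. *)
Lemma two_paths_to_leq v k l :
  (k <= l)%N -> two_paths_to v k -> two_paths_to v l.
Proof.
move=> kl [[q1 q2] /= [q1k q2k q1v q2v q12]].
have [r1 r1k r1v] := source_free_path_to (origin v q1) (l - k).
have [r2 r2k r2v] := source_free_path_to (origin v q2) (l - k).
exists (q1 ++ r1, q2 ++ r2); split=> /=.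
- by rewrite size_cat q1k r1k subnKC.
- by rewrite size_cat q2k r2k subnKC.
- by rewrite path_to_cat q1v.
- by rewrite path_to_cat q2v.
- by rewrite eqseq_cat ?q1k // (negPf q12).
Qed.

Lemma two_paths_to_cons e k :
  two_paths_to (src e) k -> two_paths_to (rng e) k.+1.
Proof.
case=> -[q1 q2] /= [q1k q2k q1v q2v q12].
by exists (e :: q1, e :: q2); split;
  rewrite /= ?q1k ?q2k ?eqxx // eqseq_cons eqxx.
Qed.

Lemma two_paths_to_in_edges v : #|in_edges v| != 1%N -> two_paths_to v 1.
Proof.
move=> v_in; have v_in_gt0 : (0 < #|in_edges v|)%N.
  by rewrite card_gt0; apply: E_source_free.
have /card_gt1P[e [f []]] : (1 < #|in_edges v|)%N.
  by rewrite ltn_neqAle eq_sym v_in.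
rewrite !inE => ev fv ef; exists ([:: e], [:: f]).
by split=> //=; rewrite ?ev ?fv // eqseq_cons andbT.
Qed.

(* If only one path of each length ends at v, the vertices met when walking
   backwards from v all have in-degree 1, and they eventually repeat. *)
Lemma source_cycle_or_two_paths_to v :
  has_source_cycle E \/ exists k, two_paths_to v k.
Proof.
have [|one_path] := pselect (exists k, two_paths_to v k); [by right | left].
have in_edge (u : vertex E) : exists e, rng e = u.
  have /set0Pn[e] := E_source_free u; rewrite inE => /eqP.
  by exists e.
have [pre rng_pre] := choice in_edge.
pose back u := src (pre u).
(* Two paths to [back u] followed by the edge [pre u] would be two paths to [u]. *)
have one_path_back i : ~ exists k, two_paths_to (iter i back v) k.
  elim: i => //= i IHi [k /two_paths_to_cons]; rewrite rng_pre => h.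
  by apply: IHi; exists k.+1.
have /trajectP[i i_lt iter_eq] := looping_order back v.
set u := iter i back v in iter_eq.
(* The walk from [v] is at [u] after [i] and after [order back v] steps, so [order back v - i] steps
   lead from [u] to itself. The predecessor is taken because the criterion speaks of [k.+1]
   steps. *)
have u_cycle : fcycle back (orbit back u).
  apply/(orbitPcycle 0 3); exists (order back v - i).-1.
  by rewrite prednK ?subn_gt0 // -iterD subnK // ltnW.
have in_u w : w \in orbit back u -> #|in_edges w| == 1%N.
  rewrite -fconnect_orbit => /iter_findex <-.
  apply: contra_notT (one_path_back _).
  by rewrite /u -iterD => h; exists 1%N; apply: two_paths_to_in_edges h.
(* The orbit follows edges backwards, so reversing it gives a path. *)
exists (rev (map pre (orbit back u))).
rewrite /source_cycle /is_cycle /closed_path map_rev all_rev rev_uniq -map_comp.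
rewrite rev_cycle cycle_map -size_eq0 size_rev size_map size_orbit.
rewrite -lt0n order_gt0 /=; apply/andP; split; first (apply/andP; split).
- by apply: sub_cycle u_cycle => x y /eqP <- /=; rewrite rng_pre.
(* The source of [pre w] is [back w], and [back] is injective on an orbit that closes up. *)
- rewrite map_inj_in_uniq ?orbit_uniq //.
  exact/(orbitPcycle 0 5).
- apply/allP => _ /mapP[w wu ->]; apply: in_u.
  by rewrite [X in X \in _](eqP (next_cycle u_cycle wu)) mem_next.
Qed.

Lemma source_cycle_or_all_two_paths_to :
  has_source_cycle E \/ exists k, forall v, two_paths_to v k.
Proof.
have [|no_cycle] := pselect (has_source_cycle E); [by left | right].
have two v : exists k, two_paths_to v k.
  by have [] := source_cycle_or_two_paths_to v.
have [k kE] := choice two.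
exists (\max_v k v)%N => v.
by apply: two_paths_to_leq (kE v); apply: leq_bigmax.
Qed.

End BackwardPaths.

(** * Paths as elements of the Leavitt path algebra *)

Section PathElements.
Variables (K : fieldType) (E : fin_graph).
Let vert (v : vertex E) : leavitt K E := lclass (TVert K v).
Let edg (e : edge E) : leavitt K E := lclass (TEdge K e).
Let ghost (e : edge E) : leavitt K E := lclass (TGhost K e).

(** The head of the list is the last edge, hence the rightmost factor; the leftmost factor is the
    origin of the path. *)
Fixpoint path_elt (v : vertex E) (q : seq (edge E)) : leavitt K E :=
  if q is e :: q' then path_elt (src e) q' * edg e else vert v.

Fixpoint ghost_elt (v : vertex E) (q : seq (edge E)) : leavitt K E :=
  if q is e :: q' then ghost e * ghost_elt (src e) q' else vert v.

(** The product collapses from the inside: the initial parts of the paths give 0 or their common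
    end, and the relation for [ghost e * edg f] settles the last edges. Equal lengths make both
    paths run out together. *)
Lemma ghost_path_elt v w q r :
  size q = size r -> path_to v q -> path_to w r ->
  ghost_elt v q * path_elt w r = if (v == w) && (q == r) then vert v else 0.
Proof.
elim: q r v w => [|e q IHq] [|f r] v w //=.
  by move=> _ _ _; rewrite andbT [LHS]lvertM; case: eqP => [->|_].
move=> [qr] /andP[/eqP <- q_path] /andP[/eqP <- r_path].
rewrite -mulrA [_ * (_ * edg f)]mulrA IHq //.
have ef : ghost e * edg f = if e == f then vert (rng e) else 0.
  rewrite [LHS]lmulE; have /lclassP -> := lrel_ghost_edge K e f.
  by case: eqP.
have sf : vert (src f) * edg f = edg f.
  by rewrite [LHS]lmulE; apply/lclassP/lrel_src_edge.
rewrite eqseq_cons; case: eqVneq => [ef_src|nef_src] /=; last first.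
  rewrite mul0r mulr0 ifN //; apply: contraNN nef_src.
  by case/and3P => _ /eqP->.
case: (q == r); last by rewrite mul0r mulr0 !andbF.
rewrite ef_src sf ef andbT; case: eqVneq => [->|_]; first by rewrite eqxx.
by rewrite andbF.
Qed.

Lemma sum_vert : \sum_v vert v = 1.
Proof. by rewrite -lclass_sum. Qed.

Lemma two_paths_not_UGN k :
  (forall v : vertex E, two_paths_to v k) -> ~ UGN (leavitt K E).
Proof.
move=> two; have [q qP] := choice two.
pose Q (i : 'I_2) v := if i == 0 then (q v).1 else (q v).2.
have sizeQ i v : size (Q i v) = k by rewrite /Q; case: (qP v) => *; case: ifP.
have pathQ i v : path_to v (Q i v) by rewrite /Q; case: (qP v) => *; case: ifP.
have Q_inj v i j : (Q i v == Q j v) = (i == j).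
  have [_ _ _ _ /negPf q12] := qP v.
  case: (eqVneq i j) => [->|]; first exact: eqxx.
  by case: i j => [[|[|//]] ?] [[|[|//]] ?] //= _; rewrite ?[(q v).2 == _]eq_sym.
pose A : 'M_(2, 1) := \matrix_(i, _) \sum_v ghost_elt v (Q i v).
pose B : 'M_(1, 2) := \matrix_(_, j) \sum_v path_elt v (Q j v).
suff AB1 : A *m B = 1%:M by move/UGN_matrixP => ugn; have := ugn _ _ A B AB1.
apply/matrixP => i j; rewrite !mxE big_ord1 !mxE mulr_suml.
(* Paths ending at distinct vertices multiply to 0, so only the terms with [w = v] remain, and these
   give [vert v] if [i = j] and 0 otherwise. *)
under eq_bigr => v _.
  rewrite mulr_sumr (bigD1 v) //= big1 ?addr0; last first.
    by move=> w wv; rewrite ghost_path_elt ?sizeQ // eq_sym (negPf wv).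
  rewrite ghost_path_elt ?sizeQ // eqxx Q_inj /=.
  over.
by case: eqP => _; rewrite ?sum_vert ?big1.
Qed.

End PathElements.

Theorem theorem3p9 (E : fin_graph) (K : fieldType) (hE : source_free E) :
  UGN (leavitt K E) <-> has_source_cycle E.
Proof.
split=> [ugn|[p p_cycle]]; last exact: source_cycle_UGN p_cycle.
have [//|[k /two_paths_not_UGN]] := source_cycle_or_all_two_paths_to hE.
by move/(_ K ugn).
Qed.
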